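(* Let $G$ and $H$ be finitely presented, residually finite groups with respective filtrations $(N_i)$ and $(M_i)$. If $\Box_{(N_i)}G$ is coarsely equivalent to $\Box_{(M_i)}H$, then $\operatorname{RG}(G,(N_i))>0$ if and only if $\operatorname{RG}(H,(M_i))>0$.
   Context: Filtration: for a residually finite, finitely generated group $G$, a filtration of $G$ is a sequence $(N_i)_{i\in\mathbb{N}}$ of nested ($N_{i+1}\subseteq N_i$), normal, finite index subgroups of $G$ with $\bigcap_i N_i=\{e\}$. Box space: fix a finite generating set $S$ of $G$. The box space $\Box_{(N_i)}G$ is the disjoint union $\bigsqcup_i G/N_i$, where each component $G/N_i$ carries the Cayley graph metric with respect to the image of $S$, and the distance between any two distinct components (i.e. between points of them) is the sum of their diameters. Changing the finite generating set gives a coarsely equivalent space. Coarse equivalence: a map $\varphi:X\to Y$ between metric spaces is a coarse embedding if there are proper functions $\rho_\pm:\mathbb{R}_+\to\mathbb{R}_+$ with $\rho_-(d_X(a,b))\le d_Y(\varphi(a),\varphi(b))\le\rho_+(d_X(a,b))$ for all $a,b\in X$. It is a coarse equivalence if moreover there is $C>0$ such that every $y\in Y$ is at distance at most $C$ from $\varphi(X)$. $X$ and $Y$ are coarsely equivalent if a coarse equivalence $X\to Y$ exists. Rank gradient: $\operatorname{RG}(G,(N_i)):=\lim_{i\to\infty}\frac{\operatorname{rk}(N_i)-1}{[G:N_i]}$, where $\operatorname{rk}(N)$ is the minimal cardinality of a generating set of $N$. *)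

(* Defs.v *)
From HB Require Import structures.
From mathcomp Require Import all_boot all_order all_algebra.
From mathcomp Require Import finmap.
From mathcomp Require Import all_classical all_reals all_analysis.

Set Implicit Arguments.
Unset Strict Implicit.
Unset Printing Implicit Defensive.

Import Order.TTheory GRing.Theory Num.Theory.
Import numFieldNormedType.Exports.

Local Open Scope classical_set_scope.
Local Open Scope ring_scope.
Local Open Scope quotient_scope.
Local Open Scope group_scope.

Definition subgroup (G : groupType) (A : set G) : Prop := group_closed [in A].

Definition normal_subgroup (G : groupType) (A : set G) : Prop :=
  subgroup A /\ forall g x : G, A x -> A (x ^ g).

Definition generated (G : groupType) (S : set G) : set G :=
  smallest (@subgroup G) S.

Definition normal_closure (G : groupType) (S : set G) : set G :=
  smallest (@normal_subgroup G) S.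

Record normalSubgroup (G : groupType) := NormalSubgroup {
  nsub :> set G;
  nsubP : normal_subgroup nsub
}.

Section NormalSubgroupTheory.
Variables (G : groupType) (N : normalSubgroup G).

Lemma nsub1 : nsub N 1.
Proof. by have [[/set_mem]] := nsubP N. Qed.

Lemma nsubF x y : nsub N x -> nsub N y -> nsub N (x / y).
Proof.
by have [[_ NF] _] := nsubP N => Nx Ny; apply/set_mem/NF; apply/mem_set.
Qed.

Lemma nsubV x : nsub N x -> nsub N x^-1.
Proof. by move=> /(nsubF nsub1); rewrite mul1g. Qed.

Lemma nsubM x y : nsub N x -> nsub N y -> nsub N (x * y).
Proof. by move=> Nx /nsubV /(nsubF Nx); rewrite invgK. Qed.

Lemma nsubJ g x : nsub N x -> nsub N (x ^ g).
Proof. by have [_] := nsubP N; apply. Qed.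

End NormalSubgroupTheory.

Section QuotientGroup.
Variables (G : groupType) (N : normalSubgroup G).

Definition coset_rel : rel G := fun x y => x^-1 * y \in (N : set G).

Lemma coset_rel_refl : reflexive coset_rel.
Proof. by move=> x; apply/mem_set; rewrite mulVg; exact: nsub1. Qed.

Lemma coset_rel_sym : symmetric coset_rel.
Proof.
by move=> x y; apply/idP/idP => /set_mem/nsubV Nxy; apply/mem_set;
  move: Nxy; rewrite invgM invgK.
Qed.

Lemma coset_rel_trans : transitive coset_rel.
Proof.
move=> y x z /set_mem Nxy /set_mem Nyz; apply/mem_set.
by have := nsubM Nxy Nyz; rewrite -mulgA mulVKg.
Qed.

Canonical coset_equiv :=
  EquivRel coset_rel coset_rel_refl coset_rel_sym coset_rel_trans.

Definition quotient := {eq_quot coset_equiv}.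
HB.instance Definition _ := Choice.on quotient.
HB.instance Definition _ := EqQuotient.on quotient.

Definition quotient_one : quotient := \pi_quotient 1.
Definition quotient_inv (x : quotient) : quotient := \pi_quotient (repr x)^-1.
Definition quotient_mul (x y : quotient) : quotient :=
  \pi_quotient (repr x * repr y).

Lemma quotient_piP (x y : G) :
  \pi_quotient x = \pi_quotient y <-> nsub N (x^-1 * y).
Proof.
split=> [/eqmodP/set_mem//|Nxy].
by apply/eqmodP/mem_set.
Qed.

Lemma quotient_piM (x y : G) :
  quotient_mul (\pi_quotient x) (\pi_quotient y) = \pi_quotient (x * y).
Proof.
apply/quotient_piP; set a := repr _; set b := repr _.
have Na : nsub N (a^-1 * x) by apply/quotient_piP; rewrite reprK.
have Nb : nsub N (b^-1 * y) by apply/quotient_piP; rewrite reprK.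
have := nsubM (nsubJ b Na) Nb.
by rewrite /conjg invgM !mulgA mulgK.
Qed.

Lemma quotient_piV (x : G) :
  quotient_inv (\pi_quotient x) = \pi_quotient x^-1.
Proof.
apply/quotient_piP; set a := repr _.
have /nsubV Na : nsub N (a^-1 * x) by apply/quotient_piP; rewrite reprK.
by have := nsubJ a^-1 Na; rewrite /conjg !invgM !invgK !mulgA mulgK.
Qed.

Fact quotient_mulA : associative quotient_mul.
Proof.
move=> a b c; rewrite -[a]reprK -[b]reprK -[c]reprK.
move: (repr a) (repr b) (repr c) => x y z.
by rewrite (quotient_piM y z) (quotient_piM x y) !quotient_piM mulgA.
Qed.

Fact quotient_mul1 : left_id quotient_one quotient_mul.
Proof. by move=> x; rewrite -[x]reprK quotient_piM mul1g. Qed.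

Fact quotient_1mul : right_id quotient_one quotient_mul.
Proof. by move=> x; rewrite -[x]reprK quotient_piM mulg1. Qed.

Fact quotient_mulV : left_inverse quotient_one quotient_inv quotient_mul.
Proof. by move=> x; rewrite -[x]reprK quotient_piV quotient_piM mulVg. Qed.

Fact quotient_Vmul : right_inverse quotient_one quotient_inv quotient_mul.
Proof. by move=> x; rewrite -[x]reprK quotient_piV quotient_piM mulgV. Qed.

HB.instance Definition _ := isGroup.Build quotient
  quotient_mulA quotient_mul1 quotient_1mul quotient_mulV quotient_Vmul.

Definition quotient_map : G -> quotient := \pi_quotient.

Fact quotient_map_mul : {morph quotient_map : x y / x * y}.
Proof. by move=> x y; exact/esym/quotient_piM. Qed.

HB.instance Definition _ :=
  isMultiplicative.Build G quotient quotient_map quotient_map_mul.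

End QuotientGroup.

Section FreeGroup.
Variable T : choiceType.

(* The letter [(b, t)] is the generator [t] if [b = false], and its inverse
   otherwise. *)
Definition word := seq (bool * T).

Definition letter_inv (l : bool * T) : bool * T := (~~ l.1, l.2).

Definition word_inv (w : word) : word := rev (map letter_inv w).

Inductive free_eq : word -> word -> Prop :=
| FreeCancel u l v : free_eq (u ++ [:: l, letter_inv l & v]) (u ++ v)
| FreeRefl u : free_eq u u
| FreeSym u v : free_eq u v -> free_eq v u
| FreeTrans u v w : free_eq u v -> free_eq v w -> free_eq u w.

Definition free_rel : rel word := fun u v => `[< free_eq u v >].

Lemma free_rel_refl : reflexive free_rel.
Proof. by move=> u; apply/asboolP/FreeRefl. Qed.

Lemma free_rel_sym : symmetric free_rel.
Proof. by move=> u v; apply/asboolP/asboolP=> /FreeSym. Qed.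

Lemma free_rel_trans : transitive free_rel.
Proof.
by move=> v u w /asboolP uv /asboolP vw; apply/asboolP; exact: FreeTrans vw.
Qed.

Canonical free_equiv :=
  EquivRel free_rel free_rel_refl free_rel_sym free_rel_trans.

Definition free_group := {eq_quot free_equiv}.
HB.instance Definition _ := Choice.on free_group.
HB.instance Definition _ := EqQuotient.on free_group.

Lemma free_eq_cat u u' v v' :
  free_eq u u' -> free_eq v v' -> free_eq (u ++ v) (u' ++ v').
Proof.
move=> uu' vv'; apply: (@FreeTrans _ (u' ++ v)).
  elim: uu' => {u u' vv'} [u l w|u|u w _|u w x _ uw _ wx].
  - by rewrite -!catA; exact: FreeCancel.
  - exact: FreeRefl.
  - exact: FreeSym.
  - exact: FreeTrans uw wx.
elim: vv' => {u uu' v v'} [u l w|u|u w _|u w x _ uw _ wx].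
- by rewrite !catA; exact: FreeCancel.
- exact: FreeRefl.
- exact: FreeSym.
- exact: FreeTrans uw wx.
Qed.

Lemma letter_invK : involutive letter_inv.
Proof. by case=> b t; rewrite /letter_inv /= negbK. Qed.

Lemma word_invK : involutive word_inv.
Proof. by move=> w; rewrite /word_inv map_rev revK mapK//; exact: letter_invK. Qed.

Lemma free_eq_mulV w : free_eq (w ++ word_inv w) [::].
Proof.
elim: w => [|l w IH]; first exact: FreeRefl.
have -> : (l :: w) ++ word_inv (l :: w)
    = [:: l] ++ (w ++ word_inv w) ++ [:: letter_inv l].
  by rewrite /word_inv /= rev_cons -cats1 -catA.
apply: FreeTrans (FreeCancel [::] l [::]).
exact: (free_eq_cat (FreeRefl [:: l]) (free_eq_cat IH (FreeRefl _))).
Qed.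

Lemma free_eq_Vmul w : free_eq (word_inv w ++ w) [::].
Proof. by rewrite -{2}[w]word_invK; exact: free_eq_mulV. Qed.

Lemma free_eq_inv u v : free_eq u v -> free_eq (word_inv u) (word_inv v).
Proof.
move=> uv; apply: (@FreeTrans _ (word_inv u ++ v ++ word_inv v)).
  rewrite -{1}[word_inv u]cats0; apply: free_eq_cat (FreeRefl _) _.
  exact/FreeSym/free_eq_mulV.
rewrite catA -{2}[word_inv v]cat0s; apply: free_eq_cat (FreeRefl _).
apply: FreeTrans (free_eq_Vmul u).
exact: free_eq_cat (FreeRefl _) (FreeSym uv).
Qed.

Definition free_one : free_group := \pi_free_group [::].
Definition free_inv (x : free_group) : free_group :=
  \pi_free_group (word_inv (repr x)).
Definition free_mul (x y : free_group) : free_group :=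
  \pi_free_group (repr x ++ repr y).

Lemma free_piP (u v : word) :
  \pi_free_group u = \pi_free_group v <-> free_eq u v.
Proof. by split=> [/eqmodP/asboolP|uv]; last exact/eqmodP/asboolP. Qed.

Lemma free_piM (u v : word) :
  free_mul (\pi_free_group u) (\pi_free_group v) = \pi_free_group (u ++ v).
Proof. by apply/free_piP/free_eq_cat; apply/free_piP; rewrite reprK. Qed.

Lemma free_piV (u : word) :
  free_inv (\pi_free_group u) = \pi_free_group (word_inv u).
Proof. by apply/free_piP/free_eq_inv/free_piP; rewrite reprK. Qed.

Fact free_mulA : associative free_mul.
Proof.
move=> a b c; rewrite -[a]reprK -[b]reprK -[c]reprK.
move: (repr a) (repr b) (repr c) => x y z.
by rewrite (free_piM y z) (free_piM x y) !free_piM catA.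
Qed.

Fact free_mul1 : left_id free_one free_mul.
Proof. by move=> x; rewrite -[x]reprK free_piM. Qed.

Fact free_1mul : right_id free_one free_mul.
Proof. by move=> x; rewrite -[x]reprK free_piM cats0. Qed.

Fact free_mulV : left_inverse free_one free_inv free_mul.
Proof.
by move=> x; rewrite -[x]reprK free_piV free_piM; exact/free_piP/free_eq_Vmul.
Qed.

Fact free_Vmul : right_inverse free_one free_inv free_mul.
Proof.
by move=> x; rewrite -[x]reprK free_piV free_piM; exact/free_piP/free_eq_mulV.
Qed.

HB.instance Definition _ := isGroup.Build free_group
  free_mulA free_mul1 free_1mul free_mulV free_Vmul.

End FreeGroup.

(* [G] is isomorphic to the quotient of a free group of finite rank by the
   normal closure of finitely many relators. *)
Definition finitely_presented (G : groupType) : Prop :=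
  exists (n : nat) (r : set (free_group 'I_n)), finite_set r /\
  exists f : {multiplicative free_group 'I_n -> G},
    range f = setT /\ f @^-1` [set 1] = normal_closure r.

Definition finite_generating_set (G : groupType) (S : set G) : Prop :=
  finite_set S /\ generated S = setT.

Definition finite_index (G : groupType) (N : normalSubgroup G) : Prop :=
  finite_set [set: quotient N].

Definition subgroup_index (G : groupType) (N : normalSubgroup G) : nat :=
  #|` fset_set [set: quotient N]|.

Definition residually_finite (G : groupType) : Prop :=
  forall g : G, g <> 1 ->
    exists N : normalSubgroup G, finite_index N /\ ~ nsub N g.

Definition filtration (G : groupType) (N : nat -> normalSubgroup G) : Prop :=
  [/\ forall i, N i.+1 `<=` N i,
      forall i, finite_index (N i) &
      \bigcap_i N i = [set 1]].

(* The value is 0 if [P] is empty. *)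
Definition nat_min (P : set nat) : nat :=
  xget 0%N [set n | P n /\ forall m, P m -> (n <= m)%N].

Definition subgroup_rank (G : groupType) (A : set G) : nat :=
  nat_min [set n | exists X : set G, (X #= `I_n)%card /\ generated X = A].

Definition rank_gradient (R : realType) (G : groupType)
    (N : nat -> normalSubgroup G) : R :=
  limn (fun i => ((subgroup_rank (N i))%:R - 1) / (subgroup_index (N i))%:R : R)%R.

Definition cayley_graph (G : groupType) (S : set G) : rel G :=
  fun x y => (x^-1 * y \in S) || (y^-1 * x \in S).

Definition graph_dist (V : eqType) (e : rel V) (x y : V) : nat :=
  nat_min [set n | exists p, [/\ size p = n, path e x p & last x p = y]].

Definition diameter (R : realType) (X : Type) (d : X -> X -> R) : R :=
  sup [set r | exists x y, r = d x y].

Section BoxSpace.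
Variables (R : realType) (G : groupType) (S : set G).
Variable N : nat -> normalSubgroup G.

Definition box_space := {i : nat & quotient (N i)}.

Definition component_dist (i : nat) (x y : quotient (N i)) : R :=
  (graph_dist (cayley_graph (@quotient_map G (N i) @` S)) x y)%:R%R.

(* Only a pseudometric in general: two distinct one-point components (with
   [N i = G]) are at distance 0 + 0. *)
Definition box_dist (x y : box_space) : R :=
  if tag x == tag y then component_dist (tagged x) (tagged_as x y)
  else (diameter (@component_dist (tag x))
        + diameter (@component_dist (tag y)))%R.

End BoxSpace.

Section Coarse.
Local Open Scope ring_scope.
Variables (R : realType) (X Y : Type).
Variables (dX : X -> X -> R) (dY : Y -> Y -> R).

(* A proper function from [0, +oo[ to itself: preimages of bounded sets are
   bounded, and no continuity is required. The values of [rho] at negative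
   reals play no role. *)
Definition proper_fun (rho : R -> R) : Prop :=
  (forall t, 0 <= t -> 0 <= rho t) /\
  (forall B : set R, bounded_set B ->
     bounded_set ([set t | 0 <= t] `&` rho @^-1` B)).

Definition coarse_embedding (phi : X -> Y) : Prop :=
  exists rho_m rho_p : R -> R, [/\ proper_fun rho_m, proper_fun rho_p &
    forall a b : X, rho_m (dX a b) <= dY (phi a) (phi b) <= rho_p (dX a b)].

Definition coarse_equivalence (phi : X -> Y) : Prop :=
  coarse_embedding phi /\
  exists C : R, 0 < C /\ forall y : Y, exists x : X, dY y (phi x) <= C.

Definition coarsely_equivalent : Prop :=
  exists phi : X -> Y, coarse_equivalence phi.

End Coarse.

(* Main.v *)
(** If [N_i] contains no short elements of [G], a coarse map
    [psi : H/M_j -> G/N_i] lifts uniquely along generators: the displacement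
    [psi(y)^-1 psi(y t)] of a letter [t] is the image of exactly one short element
    of [G]. Multiplying these lifts along words gives a cocycle with values in [G]
    which kills the relators of [H], as their lifts are short elements of [N_i];
    restricted to [M_j] it is a homomorphism to [G], and a coarse inverse
    [phi] of [psi] shows that its image is a conjugate of [N_i], that is [N_i].
    So [rk(N_i) <= rk(M_j)] as soon as [phi] and [psi] match the components [i]
    and [j] of the box spaces, which happens for arbitrarily large [i] and [j]
    when [G] is infinite; and then [[H : M_j] <= K [G : N_i]], [K] being the size
    of a ball of [H]. Schreier's inequality
    [rk(N') - 1 <= [N : N'] (rk(N) - 1)] makes the sequences defining the rank
    gradients nonincreasing, so that the limits exist and can be compared along
    the matched components. *)

Require Import Defs.
From HB Require Import structures.
From mathcomp Require Import all_boot all_order all_algebra.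
From mathcomp Require Import finmap.
From mathcomp Require Import all_classical all_reals all_analysis.
From mathcomp Require Import zify lra.

Set Implicit Arguments.
Unset Strict Implicit.
Unset Printing Implicit Defensive.

Import Order.TTheory GRing.Theory Num.Theory.
Import numFieldNormedType.Exports.

Local Open Scope classical_set_scope.
Local Open Scope ring_scope.

(** * Subgroups and word balls *)

Section MultiplicativeMaps.
Local Open Scope group_scope.
Variables (G H : groupType) (f : {multiplicative G -> H}).

Lemma multiplicative1 : f 1 = 1.
Proof. by apply: (@mulIg _ (f 1)); rewrite -gmulfM !mul1g. Qed.

Lemma multiplicativeV : {morph f : x / x^-1}.
Proof. by move=> x; apply/esym/mulg1_eq; rewrite -gmulfM mulgV multiplicative1. Qed.

End MultiplicativeMaps.

Section Subgroups.
Local Open Scope group_scope.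
Variable G : groupType.
Implicit Types (A S : set G) (N : normalSubgroup G).

Lemma subgroupP A :
  subgroup A <-> A 1 /\ forall x y, A x -> A y -> A (x / y).
Proof.
split=> [[/set_mem A1 AF]|[A1 AF]].
  by split=> // x y Ax Ay; apply/set_mem/AF; exact/mem_set.
split; first exact/mem_set.
by move=> x y /set_mem Ax /set_mem Ay; apply/mem_set/AF.
Qed.

Lemma generated_subgroup S : subgroup (generated S).
Proof.
apply/subgroupP; split=> [B [/subgroupP[]//]|x y Sx Sy B BS].
by have [/subgroupP[_ BF] _] := BS; apply: BF; [exact: Sx|exact: Sy].
Qed.

Lemma generated1 S : generated S 1.
Proof. by have /subgroupP[] := generated_subgroup S. Qed.

Lemma generatedF S x y : generated S x -> generated S y -> generated S (x / y).
Proof. by have /subgroupP[_] := generated_subgroup S; apply. Qed.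

Lemma generatedV S x : generated S x -> generated S x^-1.
Proof. by move=> /(generatedF (@generated1 S)); rewrite mul1g. Qed.

Lemma generatedM S x y : generated S x -> generated S y -> generated S (x * y).
Proof. by move=> Sx /generatedV /(generatedF Sx); rewrite invgK. Qed.

Lemma sub_generated S : S `<=` generated S.
Proof. by move=> x Sx B [_]; apply. Qed.

Lemma generated_min S A : subgroup A -> S `<=` A -> generated S `<=` A.
Proof. by move=> ? ? x; apply. Qed.

Lemma nsub_subgroup N : subgroup N.
Proof. by have [] := nsubP N. Qed.

Lemma quotient_map1 N x : quotient_map N x = 1 <-> nsub N x.
Proof.
split=> [/esym/(quotient_piP N 1 x)|Nx]; first by rewrite invg1 mul1g.
by apply/esym/(quotient_piP N 1 x); rewrite invg1 mul1g.
Qed.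

Lemma quotient_mapV N : {morph quotient_map N : x / x^-1}.
Proof. exact: multiplicativeV. Qed.

Lemma quotient_map_repr N (q : quotient N) : quotient_map N (repr q) = q.
Proof. exact: reprK. Qed.

End Subgroups.

(** Adding up the bounds of the points of [F] gives a uniform one, as [P] is monotone in its number.
    All constants taken over finite sets of generators, relators or points come from here. *)
Lemma finite_set_bound (T : choiceType) (F : set T) (P : T -> nat -> Prop) :
  finite_set F -> (forall x n m, (n <= m)%N -> P x n -> P x m) ->
  (forall x, F x -> exists n, P x n) -> exists n, forall x, F x -> P x n.
Proof.
move=> /finite_setP[k] + Pmono; elim: k F => [|k IH] F.
  by rewrite II0 card_eq0 => /eqP -> _; exists 0%N.
move=> /eq_cardSP[x Fx /IH hF] PF.
have [|n Pn] := hF; first by move=> y [Fy _]; exact: PF.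
have [m Pm] := PF x Fx.
exists (n + m)%N => y Fy; have [->|yx] := pselect (y = x).
  by apply: Pmono Pm; exact: leq_addl.
by apply: Pmono (leq_addr m n) _; apply: Pn.
Qed.

Section Balls.
Local Open Scope group_scope.

(** Allowing the letter 1 makes this the closed ball of the word metric instead of the set of
    products of exactly [n] letters. *)
Fixpoint ball (G : groupType) (S : set G) (n : nat) : set G :=
  if n is m.+1 then [set x | exists s y,
    [/\ s = 1 \/ S s \/ S s^-1, ball S m y & x = s * y]]
  else [set 1].

Variables (G : groupType) (S : set G).

Lemma ball_one n : ball S n 1.
Proof.
elim: n => //= n IH; exists 1, 1; split=> //; first by left.
by rewrite mulg1.
Qed.

Lemma ball_le n m : (n <= m)%N -> ball S n `<=` ball S m.
Proof.
elim: n m => [|n IH] m; first by move=> _ x ->; exact: ball_one.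
case: m => // m nm x [s [y [Ss Sy ->]]]; exists s, y; split=> //; exact: IH Sy.
Qed.

Lemma ballM n m x y : ball S n x -> ball S m y -> ball S (n + m) (x * y).
Proof.
elim: n x => [|n IH] x; first by move=> ->; rewrite mul1g.
move=> [s [z [Ss Sz ->]]] Sy; exists s, (z * y); split=> //; first exact: IH.
by rewrite mulgA.
Qed.

Lemma ball_letter s : S s \/ S s^-1 -> ball S 1 s.
Proof.
by move=> Ss; exists s, 1; split=> //; [right|rewrite mulg1].
Qed.

Lemma ballV n x : ball S n x -> ball S n x^-1.
Proof.
elim: n x => [|n IH] x; first by move=> ->; rewrite invg1.
move=> [s [y [Ss /IH Sy ->]]]; rewrite invgM -addn1.
apply: ballM => //; case: Ss => [->|Ss]; first by rewrite invg1; exact: ball_one.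
by apply: ball_letter; rewrite invgK; case: Ss; [right|left].
Qed.

Lemma generated_ball x : generated S x -> exists n, ball S n x.
Proof.
apply: (@generated_min _ S [set x | exists n, ball S n x]) => [|y Sy].
  2: by exists 1%N; apply: ball_letter; left.
apply/subgroupP; split=> [|y z [n ny] [m mz]]; first by exists 0%N.
by exists (n + m)%N; apply: ballM => //; exact: ballV.
Qed.

Lemma finite_ball n : finite_set S -> finite_set (ball S n).
Proof.
move=> finS; elim: n => [|n IH]; first exact: finite_set1.
have finS' : finite_set ([set 1] `|` (S `|` [set s^-1 | s in S])).
  rewrite !finite_setU; split; first exact: finite_set1.
  by split => //; exact: finite_image.
apply: sub_finite_set (finite_image (fun p => p.1 * p.2) (finite_setX finS' IH)).
move=> x [s [y [Ss Sy ->]]]; exists (s, y) => //; split=> //=.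
case: Ss => [->|[|Ss]]; [by left|by right; left|].
by right; right; exists s^-1 => //; rewrite invgK.
Qed.

Lemma finite_sub_ball (F : set G) : generated S = setT -> finite_set F ->
  exists n, F `<=` ball S n.
Proof.
move=> genS finF; apply: (finite_set_bound (P := fun x n => ball S n x) finF).
  by move=> x n m /ball_le; apply.
by move=> x _; apply: generated_ball; rewrite genS.
Qed.

Lemma ball_morph (H : groupType) (f : {multiplicative G -> H}) n :
  ball (f @` S) n = f @` ball S n.
Proof.
elim: n => [|n IH] /=.
  by rewrite image_set1 multiplicative1.
rewrite IH; apply/seteqP; split=> x.
  move=> [s [_ [Ss [y Sy <-] ->]]].
  have [t [St <-]] : exists t, (t = 1 \/ S t \/ S t^-1) /\ f t = s.
    case: Ss => [->|[[t St <-]|[t St ts]]].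
    - by exists 1; split; [left|rewrite multiplicative1].
    - by exists t; split=> //; right; left.
    - exists t^-1; split; first by right; right; rewrite invgK.
      by rewrite multiplicativeV ts invgK.
  by exists (t * y); [exists t, y|rewrite gmulfM].
move=> [_ [s [y [Ss Sy ->]]] <-]; exists (f s), (f y); split.
- case: Ss => [->|[Ss|Ss]]; first by left; rewrite multiplicative1.
    by right; left; exists s.
  by right; right; exists s^-1 => //; rewrite multiplicativeV.
- by exists y.
- by rewrite gmulfM.
Qed.

Lemma filtration_le (N : nat -> normalSubgroup G) i j :
  filtration N -> (i <= j)%N -> N j `<=` N i.
Proof.
by move=> [Nle _ _] /subnK <-; elim: (j - i)%N => // d IH x /Nle/IH.
Qed.

(** A nontrivial element misses some [N i], hence all later ones by nestedness; finitely many
    elements share a common index. *)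
Lemma finite_trivial_inter (N : nat -> normalSubgroup G) (F : set G) :
  filtration N -> finite_set F ->
  exists I, forall i, (I <= i)%N -> forall x, F x -> nsub (N i) x -> x = 1.
Proof.
move=> filN finF.
have [|x Fx|I hI] := finite_set_bound (P := fun x I => nsub (N I) x -> x = 1) finF.
- by move=> x n m nm h Nx; apply: h; exact: filtration_le filN nm _ Nx.
- have [x1|x1] := pselect (x = 1); first by exists 0%N.
  apply: contrapT => /forallNP h; apply: x1; have [_ _ Ncap] := filN.
  have : (\bigcap_i N i) x by move=> i _; apply: contrapT => Nx; apply: (h i).
  by rewrite Ncap.
- by exists I => i Ii x Fx Nx; apply: hI => //; exact: filtration_le filN Ii _ Nx.
Qed.

Lemma ball_trivial_inter (N : nat -> normalSubgroup G) k :
  finite_set S -> filtration N ->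
  exists I, forall i, (I <= i)%N -> forall x, ball S k x -> nsub (N i) x -> x = 1.
Proof. by move=> finS filN; exact/(finite_trivial_inter filN)/finite_ball. Qed.

End Balls.

(** * Distances in Cayley graphs through word balls *)

Section CayleyDistance.
Local Open Scope group_scope.

(** Well-ordering: on a nonempty set, [nat_min] is a true minimum and not its default value 0. *)
Lemma nat_minP (P : set nat) : P !=set0 ->
  P (nat_min P) /\ forall m, P m -> (nat_min P <= m)%N.
Proof.
move=> [m Pm]; rewrite /nat_min.
have eP : exists n, `[< P n >] by exists m; apply/asboolP.
case: (ex_minnP eP) => n /asboolP Pn minn.
have := @xgetPex _ 0%N [set n | P n /\ forall m, P m -> (n <= m)%N].
by apply; exists n; split=> // k Pk; apply: minn; apply/asboolP.
Qed.

Variables (G : groupType) (S : set G).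
Hypothesis genS : generated S = setT.

Lemma path_ball x p : path (cayley_graph S) x p ->
  ball S (size p) (x^-1 * last x p).
Proof.
elim: p x => [|y p IH] x /=; first by rewrite mulVg.
move=> /andP[xy /IH yp]; exists (x^-1 * y), (y^-1 * last y p); split=> //.
  right; case/orP: xy => /set_mem; [by left|right].
  by rewrite invgM invgK.
by rewrite !mulgA mulgK.
Qed.

Lemma ball_path n x y : ball S n (x^-1 * y) ->
  exists p, [/\ (size p <= n)%N, path (cayley_graph S) x p & last x p = y].
Proof.
elim: n x => [|n IH] x /=.
  by move=> /mulg1_eq; rewrite invgK => <-; exists [::].
move=> [s [z [Ss Sz xy]]].
have := IH (x * s); rewrite invgM -mulgA xy mulKg => /(_ Sz)[p [sp pp lp]].
(* The letter 1 need not be an edge, so it is dropped; the path then has length at most [n], not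
   exactly [n]. *)
case: Ss => [s1|Ss].
  by rewrite s1 mulg1 in pp lp; exists p; split=> //; exact: leqW.
exists (x * s :: p); split=> //=; rewrite pp andbT /cayley_graph mulKg.
rewrite invgM -mulgA mulVg mulg1.
by apply/orP; case: Ss => ?; [left|right]; apply/mem_set.
Qed.

(** As [S] generates, some path joins [x] to [y], which rules out the default value of [nat_min]. *)
Lemma graph_dist_le n x y :
  (graph_dist (cayley_graph S) x y <= n)%N <-> ball S n (x^-1 * y).
Proof.
have : [set n | exists p, [/\ size p = n, path (cayley_graph S) x p
    & last x p = y]] !=set0.
  have [k] : exists k, ball S k (x^-1 * y).
    by apply: generated_ball; rewrite genS.
  by move=> /ball_path[p [_ pp lp]]; exists (size p); exists p.
move=> /nat_minP[[p [sp pp lp]] minp]; split.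
  by move=> dn; rewrite -lp; apply: ball_le (path_ball pp); rewrite sp.
by move=> /ball_path[q [sq pq lq]]; apply: leq_trans sq; apply: minp; exists q.
Qed.

End CayleyDistance.

(** * Lifting a coarse map to a homomorphism *)

Section FreeGroupWords.
Local Open Scope quotient_scope.
Local Open Scope group_scope.
Variable T : choiceType.

Definition of_word (w : word T) : free_group T := \pi_(free_group T) w.

Lemma of_wordP u v : of_word u = of_word v <-> free_eq u v.
Proof. exact: free_piP. Qed.

Lemma of_wordM u v : of_word (u ++ v) = of_word u * of_word v.
Proof. exact/esym/free_piM. Qed.

Lemma of_wordV u : of_word (word_inv u) = (of_word u)^-1.
Proof. exact/esym/free_piV. Qed.

Lemma of_word_nil : of_word [::] = 1.
Proof. by []. Qed.

Lemma of_word_surj z : exists w, of_word w = z.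
Proof. by exists (repr z); exact: reprK. Qed.

End FreeGroupWords.

Section WordCocycle.
Local Open Scope group_scope.
Variables (G H : groupType) (S : set G).
Variables (N : normalSubgroup G) (M : normalSubgroup H).
Variables (n : nat) (r : set (free_group 'I_n)).
Variable f : {multiplicative free_group 'I_n -> H}.
Variable psi : quotient M -> quotient N.
Variables (R K : nat) (a : quotient M -> bool * 'I_n -> G).

Definition word_eval (w : word 'I_n) : H := f (of_word w).

(** The word [w] traces a path from [y] in the quotient by [M]; the chosen lifts [a] of the
    displacements of [psi] along this path are multiplied in [G]. *)
Fixpoint word_cocycle (y : quotient M) (w : word 'I_n) : G :=
  if w is l :: w' then
    a y l * word_cocycle (y * quotient_map M (word_eval [:: l])) w'
  else 1.

Hypothesis kerf : f @^-1` [set 1] = normal_closure r.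
Hypothesis a_ball : forall y l, ball S R (a y l).
Hypothesis a_lift : forall y l, quotient_map N (a y l) =
  (psi y)^-1 * psi (y * quotient_map M (word_eval [:: l])).
Hypothesis N_triv : forall x, ball S K x -> nsub N x -> x = 1.
Hypothesis leRK : (R + R <= K)%N.
Hypothesis relK : forall z, r z ->
  exists2 w : word 'I_n, z = of_word w & (R * size w <= K)%N.

Lemma word_eval_cat u v : word_eval (u ++ v) = word_eval u * word_eval v.
Proof. by rewrite /word_eval of_wordM gmulfM. Qed.

Lemma word_eval_nil : word_eval [::] = 1.
Proof. by rewrite /word_eval of_word_nil multiplicative1. Qed.

Lemma word_eval_inv w : word_eval (word_inv w) = (word_eval w)^-1.
Proof. by rewrite /word_eval of_wordV multiplicativeV. Qed.

Lemma word_eval_cons l w : word_eval (l :: w) = word_eval [:: l] * word_eval w.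
Proof. exact: (word_eval_cat [:: l]). Qed.

Lemma word_cocycle_cat y u v : word_cocycle y (u ++ v) =
  word_cocycle y u * word_cocycle (y * quotient_map M (word_eval u)) v.
Proof.
elim: u y => [|l u IH] y /=.
  by rewrite word_eval_nil multiplicative1 mulg1 mul1g.
by rewrite IH (word_eval_cons l u) quotient_map_mul !mulgA.
Qed.

Lemma word_cocycle_ball y w : ball S (R * size w) (word_cocycle y w).
Proof.
elim: w y => [|l w IH] y; first by rewrite /= muln0.
by rewrite /= mulnS; exact: ballM.
Qed.

Lemma word_cocycle_lift y w : quotient_map N (word_cocycle y w) =
  (psi y)^-1 * psi (y * quotient_map M (word_eval w)).
Proof.
elim: w y => [|l w IH] y /=.
  by rewrite word_eval_nil !multiplicative1 mulg1 mulVg.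
rewrite quotient_map_mul a_lift IH (word_eval_cons l w) quotient_map_mul.
by rewrite !mulgA mulgK.
Qed.

(** The path of [w] closes up, so the cocycle lies in [N] by [word_cocycle_lift]; it is also short,
    and [N] has no short element but 1. *)
Lemma word_cocycle_eq1 y w : (R * size w <= K)%N -> word_eval w = 1 ->
  word_cocycle y w = 1.
Proof.
move=> wK w1; apply: N_triv; first exact/(ball_le wK)/word_cocycle_ball.
by apply/quotient_map1; rewrite word_cocycle_lift w1 multiplicative1 mulg1 mulVg.
Qed.

(** The lifts of a letter and of its inverse are chosen independently, but a cancelling pair is a
    word of length 2 with value 1, and [R + R <= K] makes its cocycle trivial. *)
Lemma word_cocycle_free u v y : free_eq u v ->
  word_cocycle y u = word_cocycle y v.
Proof.
move=> uv; elim: uv y => {u v} [u l v|//|u v _ IH|u v w _ IH1 _ IH2] y.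
- rewrite !word_cocycle_cat; congr (_ * _); set z := y * _.
  have ev1 : word_eval [:: l; letter_inv l] = 1.
    by rewrite -word_eval_nil /word_eval; congr (f _);
      exact/of_wordP/(FreeCancel [::] l [::]).
  rewrite (word_cocycle_cat z [:: l; letter_inv l] v) ev1.
  rewrite multiplicative1 mulg1 word_cocycle_eq1 ?mul1g //=.
  by rewrite muln2 -addnn.
- by rewrite IH.
- by rewrite IH1 IH2.
Qed.

(** The relators have words short enough for [word_cocycle_eq1], and the elements with trivial
    cocycle form a normal subgroup, which therefore contains the kernel of [f]. *)
Lemma word_cocycle_ker y w : word_eval w = 1 -> word_cocycle y w = 1.
Proof.
(* Conjugation moves the base point, so triviality is required at every [y]; the condition [f z = 1]
   keeps the base point fixed in products. *)
pose A := [set z | f z = 1 /\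
  forall y w, of_word w = z -> word_cocycle y w = 1].
have AP v : word_eval v = 1 -> (forall x, word_cocycle x v = 1) -> A (of_word v).
  by move=> v1 cv; split=> // x t /of_wordP/word_cocycle_free ->.
have sA : normal_subgroup A.
  split.
    apply/subgroupP; split.
      by rewrite -of_word_nil; apply: AP => //; exact: word_eval_nil.
    move=> z t; have [v <-] := of_word_surj z; have [v' <-] := of_word_surj t.
    move=> [fv Av] [fv' Av']; rewrite -of_wordV -of_wordM; apply: AP => [|x].
      by rewrite word_eval_cat word_eval_inv /word_eval fv fv' invg1 mulg1.
    rewrite word_cocycle_cat Av // /word_eval fv multiplicative1 mulg1 mul1g.
    have := word_cocycle_free x (free_eq_mulV v').
    by rewrite word_cocycle_cat Av' // /word_eval fv' multiplicative1 mulg1 mul1g.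
  move=> g z; have [v <-] := of_word_surj g; have [v' <-] := of_word_surj z.
  move=> [fv' Av']; have {}fv' : word_eval v' = 1 := fv'.
  rewrite /conjg -of_wordV -(of_wordM v' v) -of_wordM; apply: AP => [|x].
    by rewrite !word_eval_cat word_eval_inv fv' mul1g mulVg.
  rewrite !word_cocycle_cat (Av' _ v') // fv'.
  rewrite multiplicative1 mulg1 mul1g -word_cocycle_cat.
  by rewrite (word_cocycle_free _ (free_eq_Vmul v)).
have rA : r `<=` A.
  move=> z rz; have fz : f z = 1.
    have : normal_closure r z by move=> B [_]; apply.
    by rewrite -kerf.
  split=> // x u uz; have [v zv vK] := relK rz.
  have uv : free_eq u v by apply/of_wordP; rewrite uz zv.
  rewrite (word_cocycle_free _ uv) word_cocycle_eq1 //.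
  by rewrite /word_eval -zv.
move=> w1; have : normal_closure r (of_word w) by rewrite -kerf.
by move=> /(_ A (conj sA rA))[_]; apply.
Qed.

Lemma word_cocycle_eval y u v : word_eval u = word_eval v ->
  word_cocycle y u = word_cocycle y v.
Proof.
move=> uv; have uV : word_eval (u ++ word_inv v) = 1.
  by rewrite word_eval_cat word_eval_inv uv mulgV.
have vV : word_eval (v ++ word_inv v) = 1.
  by rewrite word_eval_cat word_eval_inv mulgV.
have := word_cocycle_ker y uV; rewrite -(word_cocycle_ker y vV).
by rewrite !word_cocycle_cat uv => /mulIg.
Qed.

Variables (phi : quotient N -> quotient M) (u : quotient N -> G) (C R' : nat).
Hypothesis fsurj : range f = setT.
Hypothesis genS : generated S = setT.
Hypothesis phi_word : forall x s, S s \/ S s^-1 -> exists2 w : word 'I_n,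
  (size w <= R')%N &
  (phi x)^-1 * phi (x * quotient_map N s) = quotient_map M (word_eval w).
Hypothesis u_ball : forall x, ball S C (u x).
Hypothesis u_lift : forall x, quotient_map N (u x) = x^-1 * psi (phi x).
Hypothesis leCK : (R * R' + (C + 1 + C) <= K)%N.

(* Both sides are cocycles in [g] over [quotient N], and on a generator [g]
   they are short lifts of the same element, hence equal. *)
Lemma word_cocycle_conj g x : exists w : word 'I_n,
  word_cocycle (phi x) w = (u x)^-1 * g * u (x * quotient_map N g) /\
  phi x * quotient_map M (word_eval w) = phi (x * quotient_map N g).
Proof.
have [k] : exists k, ball S k g by apply: generated_ball; rewrite genS.
elim: k g x => [|k IH] g x.
  move=> ->; exists [::] => /=.
  by rewrite word_eval_nil !multiplicative1 !mulg1 mulVg.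
move=> [s [t [Ss kt ->]]].
have [s1|/eqP s1] := pselect (s = 1); first by rewrite s1 mul1g; exact: IH.
have {s1} Ss : S s \/ S s^-1 by case: Ss => // ss; rewrite ss eqxx in s1.
have [v vR' phiv] := phi_word x Ss.
have phisv : phi x * quotient_map M (word_eval v) = phi (x * quotient_map N s).
  by rewrite -phiv mulVKg.
have cv : word_cocycle (phi x) v = (u x)^-1 * s * u (x * quotient_map N s).
  (* Both sides lift the same element of the quotient by [N]. Their quotient has length at most
     [R * R'] from the cocycle plus [C + 1 + C] from the conjugated letter, which is below [K]. *)
  apply/divg1_eq; apply: N_triv.
    apply: (ball_le leCK); apply: ballM.
      apply: ball_le (word_cocycle_ball _ _).
      by rewrite leq_mul2l vR' orbT.
    apply: ballV; apply: ballM => //; apply: ballM; first exact: ballV.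
    exact: ball_letter.
  apply/quotient_map1; rewrite quotient_map_mul quotient_mapV; apply/eqP.
  rewrite divg_eq1 word_cocycle_lift phisv !quotient_map_mul quotient_mapV !u_lift.
  by rewrite !invgM invgK !mulgA !mulgK.
have [w [cw pw]] := IH t (x * quotient_map N s) kt.
exists (v ++ w); split.
  by rewrite word_cocycle_cat phisv cv cw quotient_map_mul !mulgA mulgK.
by rewrite word_eval_cat !quotient_map_mul mulgA phisv pw mulgA.
Qed.

(** Elements of [M] fix the base point, so the cocycle is a homomorphism from [M] to [N]. By
    [word_cocycle_conj] every element of [N] is reached, up to conjugation by [u 1], so generators
    of [M] are carried to generators of [N]. *)
Lemma generated_transfer (X : set H) : generated X = M ->
  exists th : H -> G, generated (th @` X) = N.
Proof.
move=> genX.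
have /choice[wd wdP] : forall h, exists w, word_eval w = h.
  move=> h; have : range f h by rewrite fsurj.
  by move=> [z _ <-]; have [w <-] := of_word_surj z; exists w.
pose th0 h := word_cocycle (phi 1) (wd h).
have th0E w : th0 (word_eval w) = word_cocycle (phi 1) w.
  by apply: word_cocycle_eval; rewrite wdP.
have th0M h h' : nsub M h -> th0 (h * h') = th0 h * th0 h'.
  move=> /quotient_map1 Mh.
  rewrite -[h]wdP -[h']wdP -word_eval_cat !th0E word_cocycle_cat wdP Mh.
  by rewrite mulg1.
have Mth0 h : nsub M h -> nsub N (th0 h).
  move=> /quotient_map1 Mh; apply/quotient_map1.
  by rewrite word_cocycle_lift wdP Mh mulg1 mulVg.
have th01 : th0 1 = 1 by rewrite -word_eval_nil th0E.
(* This undoes the conjugation by [u 1] that appears in [word_cocycle_conj] at the base point 1. *)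
pose th h := (th0 h) ^ (u 1)^-1.
have thM h h' : nsub M h -> th (h * h') = th h * th h'.
  by move=> Mh; rewrite /th th0M // conjMg.
have th1 : th 1 = 1 by rewrite /th th01 conj1g.
have thV h : nsub M h -> th h^-1 = (th h)^-1.
  by move=> Mh; apply/esym/mulg1_eq; rewrite -thM // mulgV.
have XM : X `<=` M by rewrite -genX; exact: sub_generated.
exists th; apply/seteqP; split.
  apply: generated_min => [|_ [x Xx <-]]; first exact: nsub_subgroup.
  by apply: nsubJ; apply: Mth0; exact: XM.
move=> g Ng; have [w [cw pw]] := word_cocycle_conj g 1.
have /quotient_map1 g1 := Ng; rewrite g1 !mulg1 in cw pw.
(* For [g] in [N] the path of [w] returns to [phi 1]. *)
have Mw : nsub M (word_eval w).
  by apply/quotient_map1; apply: (@mulgI _ (phi 1)); rewrite pw mulg1.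
have -> : g = th (word_eval w).
  by rewrite /th th0E cw /conjg invgK !mulgA mulgK mulgV mul1g.
have : [set h | nsub M h /\ generated (th @` X) (th h)] (word_eval w).
  have : generated X (word_eval w) by rewrite genX.
  apply: generated_min.
    apply/subgroupP; split.
      by split; [exact: nsub1|rewrite th1; exact: generated1].
    move=> x y [Mx gx] [My gy]; split; first exact: nsubF.
    by rewrite thM // thV //; exact: generatedF.
  by move=> x Xx; split; [exact: XM|apply: sub_generated; exists x].
by case.
Qed.

End WordCocycle.

(** * Schreier's inequality and the rank gradient *)

Section RankAndIndex.
Local Open Scope group_scope.

(** Duplicate-free lists link the cardinals behind [subgroup_index] and [subgroup_rank] to the
    counting lemmas on sequences. *)
Definition enumerates (T : eqType) (A : set T) (s : seq T) : Prop :=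
  uniq s /\ forall x, x \in s <-> A x.

Lemma finite_set_enum (T : choiceType) (A : set T) :
  finite_set A -> exists s, enumerates A s.
Proof.
move=> finA; exists (enum_fset (fset_set A)); split; first exact: fset_uniq.
move=> x; rewrite -/(x \in fset_set A) in_fset_set //.
by split=> [/set_mem|/mem_set].
Qed.

Lemma enumerates_card (T : choiceType) (A : set T) s :
  enumerates A s -> (A #= `I_(size s))%card.
Proof.
move=> [us sA]; have -> : A = [set` [fset x in s]%fset].
  by apply/seteqP; split=> x /=; rewrite inE; move=> ?; exact/sA.
by apply/card_eq_fsetP; rewrite card_fseq undup_id.
Qed.

Lemma enumerates_size (T : choiceType) (A : set T) s t :
  enumerates A s -> enumerates A t -> size s = size t.
Proof.
move=> [us sA] [ut tA]; apply/eqP; rewrite -uniq_size_uniq //.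
by move=> x; apply/idP/idP => xs; [apply/sA/tA|apply/tA/sA].
Qed.

Lemma subgroup_index_enum (G : groupType) (N : normalSubgroup G) s :
  enumerates [set: quotient N] s -> subgroup_index N = size s.
Proof. by move=> /enumerates_card/card_fset_set. Qed.

(** A finite generating list, once its repetitions are removed, shows that the minimum defining the
    rank is over a nonempty set and is attained. *)
Lemma subgroup_rankP (G : groupType) (A : set G) (s : seq G) :
  generated [set` s] = A ->
  (subgroup_rank A <= size s)%N /\
  exists2 t : seq G, size t = subgroup_rank A & generated [set` t] = A.
Proof.
move=> genA.
have Prank : [set n | exists X : set G,
    (X #= `I_n)%card /\ generated X = A] (size (undup s)).
  exists [set` s]; split=> //; apply: enumerates_card.
  by split=> [|x]; [exact: undup_uniq|rewrite mem_undup].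
have [[X [cX gX]] minr] := nat_minP (ex_intro _ _ Prank).
split; first exact: leq_trans (minr _ Prank) (size_undup s).
have [t [ut tX]] : exists t, enumerates X t.
  by apply: finite_set_enum; apply/finite_setP; exists (subgroup_rank A).
exists t.
  have /card_fset_set := enumerates_card (conj ut tX).
  by have /card_fset_set -> := cX.
by rewrite -gX; congr generated; apply/seteqP; split=> x ?; exact/tX.
Qed.

End RankAndIndex.

Section Schreier.
Local Open Scope group_scope.
Variables (G : groupType) (N : normalSubgroup G) (X : seq G).
Variable s : seq (quotient N).
Hypothesis sub_N : N `<=` generated [set` X].
Hypothesis sX : enumerates (quotient_map N @` generated [set` X]) s.
Notation pi := (quotient_map N).

(* [P] collects the edges of a spanning tree of the Schreier graph, grown one
   vertex at a time. *)
Lemma schreier_tree k : (k < size s)%N ->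
  exists (T : seq G) (P : seq (G * G)),
    [/\ size T = k.+1, size P = k, 1 \in T /\ uniq (map pi T),
        uniq P /\ (forall t, t \in T -> generated [set` X] t) &
        forall p, p \in P -> [/\ p.1 \in T, p.2 \in X & p.1 * p.2 \in T]].
Proof.
elim: k => [|k IH] ks.
  exists [:: 1], [::]; split=> //; first by split; rewrite ?mem_head.
  by split=> // t; rewrite inE => /eqP ->; exact: generated1.
have [T [P [sT sP [T1 uT] [uP TX] PT]]] := IH (ltnW ks).
(* Some edge leaves the tree: otherwise the image of [T] would be stable under all letters and
   contain the [size s] cosets, while [T] has fewer elements. *)
have [t [x [tT Xx tx]]] : exists t x,
    [/\ t \in T, x \in X \/ x^-1 \in X & pi (t * x) \notin map pi T].
  apply: contrapT => nex.
  have clo n g : ball [set` X] n g -> forall t, t \in T -> pi (t * g) \in map pi T.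
    elim: n g => [|n IHn] g; first by move=> -> t tT; rewrite mulg1 map_f.
    move=> [x [y [Xx ny ->]]] t tT.
    have : pi (t * x) \in map pi T.
      case: Xx => [->|Xx]; first by rewrite mulg1 map_f.
      by apply: contrapT => /negP tx; apply: nex; exists t, x.
    case/mapP => t' t'T tt'.
    by rewrite mulgA quotient_map_mul tt' -quotient_map_mul IHn.
  suff : (size s <= size (map pi T))%N by rewrite size_map sT leqNgt ks.
  apply: uniq_leq_size; first by case: sX.
  move=> q; case: sX => _ sXP /sXP[g Xg <-].
  have [n /clo/(_ 1 T1)] := generated_ball Xg.
  by rewrite mul1g.
have txT : t * x \notin T by apply: contra tx => /(map_f pi).
have Xtx : generated [set` X] (t * x).
  apply: generatedM; first exact: TX.
  case: Xx => ?; first exact: sub_generated.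
  by rewrite -[x]invgK; apply: generatedV; exact: sub_generated.
(* Edges are labelled by elements of [X] only, so an edge travelled backwards is recorded from its
   new endpoint [t * x]. *)
pose p := if x \in X then (t, x) else (t * x, x^-1).
exists (t * x :: T), (p :: P); split=> /=.
- by rewrite sT.
- by rewrite sP.
- by rewrite inE T1 orbT tx uT.
- split=> [|t']; last by rewrite inE => /orP[/eqP ->|/TX].
  rewrite uP andbT; apply/negP => /PT; rewrite /p.
  by case: ifP => _ [/= h1 _ h2]; [rewrite h2 in txT|rewrite h1 in txT].
- move=> q; rewrite inE => /orP[/eqP ->|/PT[h1 h2 h3]]; last first.
    by rewrite !inE h1 h3 !orbT.
  rewrite /p; case: ifP => [xX|xX] /=; first by rewrite !inE eqxx tT orbT.
  rewrite !inE mulgK eqxx tT orbT; split=> //.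
  by case: Xx => //; rewrite xX.
Qed.

(** The Schreier generators [t * x / rep (t * x)] are indexed by [T] and [X], and the [(size s).-1]
    tree edges give trivial ones. The bound is [size Y - 1 <= size s * (size X - 1)] written without
    subtraction. *)
Lemma schreier : exists2 Y : seq G,
  (size Y + (size s).-1 <= size s * size X)%N & generated [set` Y] = N.
Proof.
have s_gt0 : (0 < size s)%N.
  have : pi 1 \in s by apply/(proj2 sX); exists 1 => //; exact: generated1.
  by case: (s).
have [|T [P [sT sP [T1 uT] [uP TX] PT]]] := @schreier_tree (size s).-1.
  by rewrite prednK.
rewrite prednK // in sT.
have [_ Ts] : (size (map pi T) = size s) * (map pi T =i s).
  apply: uniq_min_size => //; last by rewrite size_map sT.
  by move=> q /mapP[t /TX Xt ->]; apply/(proj2 sX); exists t.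
have Tcover g : generated [set` X] g -> pi g \in map pi T.
  by move=> Xg; rewrite Ts; apply/(proj2 sX); exists g.
pose rep (g : G) := nth 1 T (index (pi g) (map pi T)).
have rep_mem g : generated [set` X] g -> rep g \in T.
  by move=> /Tcover gT; rewrite mem_nth // -(size_map pi) index_mem.
have rep_pi g : generated [set` X] g -> pi (rep g) = pi g.
  move=> /Tcover gT; rewrite -[LHS](nth_map 1 (pi 1)) ?nth_index //.
  by rewrite -(size_map pi) index_mem.
have rep_eq g h : pi g = pi h -> rep g = rep h by rewrite /rep => ->.
have rep_id t : t \in T -> rep t = t.
  move=> tT; rewrite /rep -[t in index (pi t)](nth_index 1 tT).
  rewrite -(nth_map 1 (pi 1)) ?index_mem // index_uniq ?size_map ?index_mem //.
  exact: nth_index.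
pose L := allpairs pair T X.
pose sgen (p : G * G) := p.1 * p.2 / rep (p.1 * p.2).
pose Y := map sgen [seq p <- L | p \notin P].
have LP p : p \in L -> p.1 \in T /\ p.2 \in X.
  by move=> /allpairsP[[t x] /= [tT xX ->]].
have XX x : x \in X -> generated [set` X] x by exact: sub_generated.
have genY t x : t \in T -> x \in X -> generated [set` Y] (sgen (t, x)).
  move=> tT xX; have [txP|txP] := boolP ((t, x) \in P).
    have [_ _ txT] := PT _ txP.
    by rewrite /sgen /= rep_id // mulgV; exact: generated1.
  apply: sub_generated; apply/mapP; exists (t, x) => //.
  rewrite mem_filter /= txP; exact: allpairs_f.
exists Y.
  (* [X] may have repetitions, so the pairs of [L] in [P] are only bounded below by [size P]; this
     is the needed direction. *)
  rewrite size_map size_filter -sP -sT -(size_allpairs pair T X) -/L.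
  rewrite -(count_predC (mem P) L) addnC leq_add2r -(size_filter (mem P)).
  apply: uniq_leq_size => // -[t x] /[dup] /PT[/= tT xX _] txP.
  by rewrite mem_filter /= txP; exact: allpairs_f.
apply/seteqP; split.
  apply: generated_min; first exact: nsub_subgroup.
  move=> _ /mapP[[t x] + ->]; rewrite mem_filter => /andP[_ /LP[/= tT xX]].
  have Xtx : generated [set` X] (t * x) by apply: generatedM; [exact: TX|exact: XX].
  apply/quotient_map1; rewrite /sgen /= quotient_map_mul quotient_mapV.
  by rewrite rep_pi // mulgV.
(* Reschke-free telescoping: reading a word letter by letter, the representative left by one
   Schreier generator starts the next. *)
have genball n g t : ball [set` X] n g -> t \in T ->
    generated [set` Y] (t * g / rep (t * g)).
  elim: n g t => [|n IH] g t.
    by move=> -> tT; rewrite mulg1 rep_id // mulgV; exact: generated1.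
  move=> [x [h [Xx nh ->]]] tT.
  have Xtx : generated [set` X] (t * x).
    apply: generatedM; first exact: TX.
    case: Xx => [->|[]]; [exact: generated1|exact: XX|].
    by move=> /XX /generatedV; rewrite invgK.
  have tx : generated [set` Y] (t * x / rep (t * x)).
    case: Xx => [->|[|] xX].
    - by rewrite mulg1 rep_id // mulgV; exact: generated1.
    - exact: genY.
    (* For an inverse letter, the Schreier generator of the reversed edge from [rep (t * x)] is the
       inverse of the wanted element. *)
    - have := genY _ _ (rep_mem _ Xtx) xX; rewrite /sgen /=.
      have -> : rep (rep (t * x) / x) = t.
        rewrite -[RHS]rep_id //; apply: rep_eq.
        by rewrite quotient_map_mul rep_pi // -quotient_map_mul mulgK.
      by move=> /generatedV; rewrite !invgM !invgK !mulgA.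
  have := generatedM tx (IH h (rep (t * x)) nh (rep_mem _ Xtx)).
  rewrite (rep_eq (rep (t * x) * h) (t * (x * h))); last first.
    by rewrite quotient_map_mul rep_pi // -quotient_map_mul mulgA.
  by rewrite !mulgA mulgVK.
move=> g Ng; have [n ng] := generated_ball (sub_N Ng).
have := genball n g 1 ng T1; rewrite mul1g (rep_eq g 1).
  by rewrite rep_id // divg1.
by have /quotient_map1 -> := Ng; rewrite multiplicative1.
Qed.

(** Multiplicativity of the index: a coset of [N] is uniquely the product of a chosen representative
    of a coset of [N0] with a coset of [N] inside [N0]. *)
Lemma quotient_extension_size (N0 : normalSubgroup G) s0 s1 :
  nsub N0 = generated [set` X] ->
  enumerates [set: quotient N0] s0 -> enumerates [set: quotient N] s1 ->
  size s1 = (size s0 * size s)%N.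
Proof.
move=> N0X [us0 s0P] s1P; rewrite -(size_allpairs (fun q a => pi (repr q) * a)).
apply: enumerates_size s1P _; have [us sP] := sX.
have fiber q h q' h' : nsub N0 h -> nsub N0 h' ->
    pi (repr q * h) = pi (repr q' * h') -> q = q' :> quotient N0.
  move=> /quotient_map1 Nh /quotient_map1 Nh' /(quotient_piP N) /sub_N.
  rewrite -N0X => /(quotient_piP N0); rewrite -!/(quotient_map N0 _).
  by rewrite !quotient_map_mul Nh Nh' !mulg1 !quotient_map_repr.
split.
  apply: allpairs_uniq => // -[q a] [q' a'].
  move=> /allpairsP[[? ?] /= [_ /sP[h Xh ha] [-> ->]]] /=.
  move=> /allpairsP[[? ?] /= [_ /sP[h' Xh' ha'] [-> ->]]] /=.
  rewrite -ha -ha' -!quotient_map_mul => qq'.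
  have qE := fiber _ _ _ _ _ _ qq'; rewrite qE ?N0X // in qq' *.
  by move: qq'; rewrite !quotient_map_mul => /mulgI ->.
move=> x; split=> // _; rewrite -[x]quotient_map_repr; set g := repr x.
apply/allpairsP; exists (quotient_map N0 g, pi ((repr (quotient_map N0 g))^-1 * g)).
split=> /=; first exact/s0P.
  apply/sP; exists ((repr (quotient_map N0 g))^-1 * g) => //.
  by rewrite -N0X; apply/(quotient_piP N0); exact: quotient_map_repr.
by rewrite -quotient_map_mul mulVKg.
Qed.

End Schreier.

(** * Monotonicity and limit of the rank ratios *)

Section RankGradient.
Variables (R : realType) (G : groupType) (S : set G).
Variable N : nat -> normalSubgroup G.
Hypothesis genS : finite_generating_set S.
Hypothesis filN : filtration N.

Definition rank_ratio (i : nat) : R :=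
  ((subgroup_rank (N i))%:R - 1) / (subgroup_index (N i))%:R.

Lemma filtration_enum i : exists s, enumerates [set: quotient (N i)] s.
Proof. by apply: finite_set_enum; have [_ + _] := filN; apply. Qed.

Lemma filtration_index_gt0 i : (0 < subgroup_index (N i))%N.
Proof.
have [s sN] := filtration_enum i; rewrite (subgroup_index_enum sN).
have [_ /(_ (quotient_one _))[_]] := sN.
by case: (s) => // /(_ I).
Qed.

Lemma filtration_image_enum (A : set G) i :
  exists s, enumerates (quotient_map (N i) @` A) s.
Proof.
apply: finite_set_enum; apply: (@sub_finite_set _ _ setT) => //.
by have [_ + _] := filN; apply.
Qed.

Lemma filtration_fg i : exists s : seq G, generated [set` s] = N i.
Proof.
have [/finite_seqP[X XS] SG] := genS; rewrite XS in SG.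
have [s sX] := filtration_image_enum (generated [set` X]) i.
have sub : N i `<=` generated [set` X] by rewrite SG.
by have [Y _ genY] := schreier sub sX; exists Y.
Qed.

(** Schreier's inequality for [N i.+1] inside [N i] multiplies the rank minus one by at most the
    relative index, and the index by exactly that factor. *)
Lemma rank_ratio_nonincreasing : {homo rank_ratio : i j / (i <= j)%N >-> j <= i}.
Proof.
apply/nonincreasing_seqP => i.
have [t tN] := filtration_fg i; have [_ [X sX genX]] := subgroup_rankP tN.
have [s sP] := filtration_image_enum (generated [set` X]) i.+1.
have sub : N i.+1 `<=` generated [set` X].
  by rewrite genX; exact: (filtration_le filN).
have [Y sY /subgroup_rankP[rkY _]] := schreier sub sP.
have [s0 s0P] := filtration_enum i; have [s1 s1P] := filtration_enum i.+1.
have := filtration_index_gt0 i; have := filtration_index_gt0 i.+1.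
have Ni : nsub (N i) = generated [set` X] by rewrite genX.
rewrite /rank_ratio (subgroup_index_enum s0P) (subgroup_index_enum s1P).
rewrite (quotient_extension_size sub sP Ni s0P s1P) muln_gt0.
move=> /andP[s0_gt0 s_gt0] _.
rewrite ler_pdivrMr ?ltr0n ?muln_gt0 ?s0_gt0 // natrM mulrA.
rewrite divfK ?pnatr_eq0 -?lt0n // -sX mulrBl mul1r.
(* The predecessor in [schreier] is truncated; [size s] being positive, it can be replaced by an
   additive form. *)
have : (subgroup_rank (N i.+1) + size s <= size X * size s + 1)%N.
  have := leq_trans _ sY; move: s_gt0; rewrite [(size s * _)%N]mulnC.
  case: (size s) => // d _; rewrite addn1 addnS ltnS; apply.
  by rewrite leq_add2r.
by rewrite -(ler_nat R) !natrD natrM; lra.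
Qed.

Lemma rank_ratio_cvg : cvgn rank_ratio.
Proof.
apply: nonincreasing_is_cvgn; first exact: rank_ratio_nonincreasing.
(* The rank is at least 0 and the index at least 1, whence the lower bound -1. *)
exists (-1) => _ [i _ <-]; rewrite /rank_ratio.
have idx := filtration_index_gt0 i.
rewrite ler_pdivlMr ?ltr0n //.
have : 1 <= (subgroup_index (N i))%:R :> R by rewrite ler1n.
by have : 0 <= (subgroup_rank (N i))%:R :> R by []; lra.
Qed.

Lemma rank_gradient_le_ratio i : rank_gradient R N <= rank_ratio i.
Proof. exact: nonincreasing_cvgn_ge rank_ratio_nonincreasing rank_ratio_cvg i. Qed.

(** For a nonincreasing sequence, a lower bound at arbitrarily large indices holds at all indices,
    hence for the limit. *)
Lemma rank_gradient_ge e :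
  (forall i, exists2 j, (i <= j)%N & e <= rank_ratio j) -> e <= rank_gradient R N.
Proof.
move=> he; apply: limr_ge; first exact: rank_ratio_cvg.
near=> i; have [j ij ej] := he i; apply: le_trans ej _.
exact: rank_ratio_nonincreasing.
Unshelve. all: by end_near. Qed.

(** If [G] were a single ball, some [N i] would be trivial, of rank 0, and its negative ratio would
    bound the rank gradient from above. *)
Lemma rank_gradient_gt0_unbounded n :
  0 < rank_gradient R N -> exists g, ~ ball S n g.
Proof.
move=> RG; apply: contrapT => /forallNP bn.
have [finS _] := genS.
have [i /(_ i (leqnn i)) Ni1] := ball_trivial_inter n finS filN.
have /subgroup_rankP[rk _] : generated [set` [::]] = N i.
  apply/seteqP; split; first by apply: generated_min => //; exact: nsub_subgroup.
  move=> g Ng; rewrite (Ni1 g) //; first exact: generated1.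
  by apply: contrapT; exact: bn.
have := lt_le_trans RG (rank_gradient_le_ratio i).
rewrite /rank_ratio; move: rk; rewrite leqn0 => /eqP ->.
by rewrite sub0r mulN1r oppr_gt0 invr_lt0 ltrn0.
Qed.

End RankGradient.

(** At matched indices the ratio of [M j] is at least that of [N i] divided by [K], so the rank
    gradient of [N] divided by [K] is a positive lower bound. *)
Lemma rank_gradient_gt0_transfer (R : realType) (G H : groupType)
    (S : set G) (T : set H) (N : nat -> normalSubgroup G)
    (M : nat -> normalSubgroup H) (K : nat) :
  finite_generating_set S -> finite_generating_set T ->
  filtration N -> filtration M ->
  (forall k, exists i j, [/\ (k <= j)%N,
    (subgroup_rank (N i) <= subgroup_rank (M j))%N &
    (subgroup_index (M j) <= subgroup_index (N i) * K)%N]) ->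
  0 < rank_gradient R N -> 0 < rank_gradient R M.
Proof.
move=> genS genT filN filM NM RG.
have K_gt0 : (0 < K)%N.
  have [i [j [_ _]]] := NM 0%N; case: (K) => //; rewrite muln0.
  by rewrite leqNgt (filtration_index_gt0 filM).
apply: (@lt_le_trans _ _ (rank_gradient R N / K%:R)).
  by rewrite divr_gt0 // ltr0n.
apply: (rank_gradient_ge genT filM) => k; have [i [j [kj rk idx]]] := NM k.
exists j => //; apply: le_trans (_ : rank_ratio R N i / K%:R <= _).
  by rewrite ler_pM2r ?invr_gt0 ?ltr0n //; exact: (rank_gradient_le_ratio R genS filN i).
(* The numerator for [N i] must be nonnegative for the fraction to decrease when its denominator
   grows. *)
have NiGT0 := lt_le_trans RG (rank_gradient_le_ratio R genS filN i).
have iN := filtration_index_gt0 filN i; have iM := filtration_index_gt0 filM j.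
move: NiGT0; rewrite /rank_ratio pmulr_lgt0 ?invr_gt0 ?ltr0n // => rk0.
rewrite -mulrA -invfM -natrM; apply: ler_pM; rewrite ?invr_ge0 ?ler0n ?(ltW rk0) //.
  by rewrite lerD2r ler_nat.
by rewrite lef_pV2 ?posrE ?ltr0n ?muln_gt0 ?iN // ler_nat.
Qed.

(** * Coarse geometry of box spaces *)

Section BoxMetric.
Local Open Scope group_scope.
Variables (R : realType) (G : groupType) (S : set G).
Variable N : nat -> normalSubgroup G.
Hypothesis genS : finite_generating_set S.
Hypothesis filN : filtration N.

Definition component_nat_dist i (x y : quotient (N i)) : nat :=
  graph_dist (cayley_graph (@quotient_map G (N i) @` S)) x y.

Definition component_diam i : nat :=
  nat_min [set n | forall x y, (@component_nat_dist i x y <= n)%N].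

Definition box_nat_dist (a b : box_space N) : nat :=
  if tag a == tag b then component_nat_dist (tagged a) (tagged_as a b)
  else (component_diam (tag a) + component_diam (tag b))%N.

(** Balls of the quotient are images of balls of [G], so a displacement in a component lifts to an
    element of [G] of the same length. *)
Lemma component_nat_dist_le i n (x y : quotient (N i)) :
  (component_nat_dist x y <= n)%N <->
  exists2 g, ball S n g & y = x * quotient_map (N i) g.
Proof.
have genSi : generated (quotient_map (N i) @` S) = setT.
  rewrite -subTset => q _; rewrite -[q]quotient_map_repr.
  have [_ SG] := genS.
  have : generated S (repr q) by rewrite SG.
  move=> /generated_ball[k Sk].
  have : ball (quotient_map (N i) @` S) k (quotient_map (N i) (repr q)).
    by rewrite ball_morph; exists (repr q).
  elim: k (quotient_map _ _) {Sk} => [|k IH] p; first by move=> ->; exact: generated1.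
  move=> [s [t [Ss /IH St ->]]]; apply: generatedM => //.
  case: Ss => [->|[|] Ss]; [exact: generated1|exact: sub_generated|].
  by rewrite -[s]invgK; apply: generatedV; exact: sub_generated.
rewrite /component_nat_dist (graph_dist_le genSi) ball_morph; split.
  by move=> [g Sg gxy]; exists g => //; rewrite gxy mulVKg.
by move=> [g Sg ->]; exists g => //; rewrite mulKg.
Qed.

Lemma component_diamP i n : (component_diam i <= n)%N <->
  forall x y : quotient (N i), (component_nat_dist x y <= n)%N.
Proof.
have ne : [set n | forall x y, (@component_nat_dist i x y <= n)%N] !=set0.
  have [_ fin _] := filN.
  have [|p _|k hk] := finite_set_bound
    (P := fun p n => (component_nat_dist p.1 p.2 <= n)%N)
    (finite_setX (fin i) (fin i)).
  - by move=> p k m km; move/leq_trans; apply.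
  - by exists (component_nat_dist p.1 p.2).
  by exists k => x y; exact: (hk (x, y) (conj I I)).
have [dub dmin] := nat_minP ne; split; last exact: dmin.
by move=> dn x y; exact: leq_trans (dub x y) dn.
Qed.

Lemma component_nat_dist_sym i (x y : quotient (N i)) :
  component_nat_dist x y = component_nat_dist y x.
Proof.
have le u v : (@component_nat_dist i u v <= component_nat_dist v u)%N.
  have /component_nat_dist_le[g Sg uE] := leqnn (component_nat_dist v u).
  apply/component_nat_dist_le; exists g^-1; first exact: ballV.
  by rewrite uE quotient_mapV mulgK.
by apply/eqP; rewrite eqn_leq !le.
Qed.

Lemma component_nat_dist_triangle i (x y z : quotient (N i)) :
  (component_nat_dist x z <= component_nat_dist x y + component_nat_dist y z)%N.
Proof.
have /component_nat_dist_le[g Sg yE] := leqnn (component_nat_dist x y).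
have /component_nat_dist_le[h Sh zE] := leqnn (component_nat_dist y z).
apply/component_nat_dist_le; exists (g * h); first exact: ballM.
by rewrite zE yE quotient_map_mul mulgA.
Qed.

Lemma box_nat_dist_same i (x y : quotient (N i)) :
  box_nat_dist (existT _ i x) (existT _ i y) = component_nat_dist x y.
Proof. by rewrite /box_nat_dist eqxx tagged_asE. Qed.

Lemma box_nat_dist_diff (a b : box_space N) : tag a != tag b ->
  box_nat_dist a b = (component_diam (tag a) + component_diam (tag b))%N.
Proof. by rewrite /box_nat_dist => /negbTE ->. Qed.

Lemma box_nat_dist_le_diam (a b : box_space N) :
  (box_nat_dist a b <= component_diam (tag a) + component_diam (tag b))%N.
Proof.
have [|ab] := eqVneq (tag a) (tag b); last by rewrite box_nat_dist_diff.
case: a b => [i x] [j y] /= ij; subst j; rewrite box_nat_dist_same.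
apply: leq_trans (leq_addr _ _).
by have /component_diamP := leqnn (component_diam i).
Qed.

Lemma box_nat_dist_sym (a b : box_space N) : box_nat_dist a b = box_nat_dist b a.
Proof.
have [|ab] := eqVneq (tag a) (tag b).
  case: a b => [i x] [j y] /= ij; subst j.
  by rewrite !box_nat_dist_same component_nat_dist_sym.
by rewrite !box_nat_dist_diff ?(eq_sym (tag b)) // addnC.
Qed.

(** As soon as two consecutive points lie in distinct components, the right-hand side contains the
    diameters that bound the left-hand side. *)
Lemma box_nat_dist_triangle (a b c : box_space N) :
  (box_nat_dist a c <= box_nat_dist a b + box_nat_dist b c)%N.
Proof.
have [|ab] := eqVneq (tag a) (tag b); have [|bc] := eqVneq (tag b) (tag c).
- case: a b c => [i x] [j y] [k z] /= jk ij; subst k j; rewrite !box_nat_dist_same.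
  exact: component_nat_dist_triangle.
- move=> ab; rewrite [X in (_ <= _ + X)%N]box_nat_dist_diff // -ab.
  exact: leq_trans (box_nat_dist_le_diam a c) (leq_addl _ _).
- move=> bc; rewrite [X in (_ <= X + _)%N]box_nat_dist_diff // bc.
  exact: leq_trans (box_nat_dist_le_diam a c) (leq_addr _ _).
- rewrite [X in (_ <= X + _)%N]box_nat_dist_diff //.
  rewrite [X in (_ <= _ + X)%N]box_nat_dist_diff //.
  by apply: leq_trans (box_nat_dist_le_diam a c) _; lia.
Qed.

Lemma box_distE : @box_dist R G S N = fun a b => (box_nat_dist a b)%:R%R.
Proof.
have diamE i : diameter (@component_dist R G S N i) = (component_diam i)%:R%R.
  have /component_diamP dub := leqnn (component_diam i).
  have ub : ubound [set r | exists x y, r = @component_dist R G S N i x y]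
      (component_diam i)%:R%R.
    by move=> _ [x [y ->]]; rewrite ler_nat; exact: dub.
  have ne : [set r | exists x y, r = @component_dist R G S N i x y] !=set0.
    by exists (@component_dist R G S N i 1 1), 1, 1.
  apply/eqP; rewrite eq_le; apply/andP; split; first exact: ge_sup.
  rewrite leNgt; apply/negP => lt.
  (* Distances are integers, so being strictly below the diameter means being at most its
     predecessor. *)
  have : (component_diam i <= (component_diam i).-1)%N.
    apply/component_diamP => x y.
    have : ((component_nat_dist x y)%:R < (component_diam i)%:R :> R)%R.
      apply: le_lt_trans lt; apply: ub_le_sup; first by exists (component_diam i)%:R%R.
      by exists x, y.
    by rewrite ltr_nat; lia.
  (* This excludes a zero [component_diam], for which the inequality with the predecessor would be
     no contradiction. *)
  have d0 : (0 <= diameter (@component_dist R G S N i))%R.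
    pose q : quotient (N i) := 1.
    apply: (@le_trans _ _ (component_nat_dist q q)%:R%R); first exact: ler0n.
    apply: ub_le_sup; first by exists (component_diam i)%:R%R.
    by exists q, q.
  have := le_lt_trans d0 lt; rewrite ltr0n; lia.
apply/funext => a; apply/funext => b; rewrite /box_dist /box_nat_dist.
by case: ifP => // _; rewrite !diamE natrD.
Qed.

(** For a finite generating set [S], this says that the group is infinite. *)
Definition unbounded_group : Prop := forall n, exists g, ~ ball S n g.

(** Take [g] outside the ball of radius [n]. For large [i] no [x^-1 * g] with [x] in that ball lies
    in [N i], so the image of [g] stays farther than [n] from 1. *)
Lemma component_diam_unbounded n : unbounded_group ->
  exists I, forall i, (I <= i)%N -> (n < component_diam i)%N.
Proof.
move=> /(_ n)[g ng]; have [finS _] := genS.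
have [I hI] := finite_trivial_inter filN
  (finite_image (fun x => x^-1 * g) (finite_ball n finS)).
exists I => i Ii; rewrite ltnNge; apply/negP => /component_diamP.
move=> /(_ 1 (quotient_map (N i) g))/component_nat_dist_le[x nx].
rewrite mul1g => /esym/(quotient_piP (N i)) Nxg.
have := hI i Ii (x^-1 * g) _ Nxg; rewrite /= => xg.
have /mulg1_eq : x^-1 * g = 1 by apply: xg; exists x.
by rewrite invgK => xE; rewrite xE in nx.
Qed.

Lemma box_nat_dist_initial I : exists D, forall a b : box_space N,
  (tag a < I)%N -> (tag b < I)%N -> (box_nat_dist a b <= D)%N.
Proof.
pose D := (\sum_(i < I) component_diam i)%N.
have le i : (i < I)%N -> (component_diam i <= D)%N.
  by move=> iI; rewrite /D (bigD1 (Ordinal iI)) //= leq_addr.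
exists (D + D)%N => a b aI bI; apply: leq_trans (box_nat_dist_le_diam a b) _.
by apply: leq_add; exact: le.
Qed.

Lemma box_nat_dist_bounded D : (forall g, ball S D g) ->
  forall a b : box_space N, (box_nat_dist a b <= D + D)%N.
Proof.
move=> SD a b; apply: leq_trans (box_nat_dist_le_diam a b) _.
have le i : (component_diam i <= D)%N.
  apply/component_diamP => x y; apply/component_nat_dist_le.
  by exists (repr (x^-1 * y)) => //; rewrite quotient_map_repr mulVKg.
by apply: leq_add.
Qed.

Lemma box_nat_dist_tag (a b : box_space N) n :
  (box_nat_dist a b <= n)%N -> (n < component_diam (tag a))%N -> tag b = tag a.
Proof.
move=> abn na; apply/eqP; apply: contraTT abn => ba.
by rewrite box_nat_dist_diff 1?eq_sym // -ltnNge ltn_addr.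
Qed.

End BoxMetric.

(** * Coarse equivalences as pairs of controlled maps *)

Section CoarsePairs.
Variables (X Y : Type) (dX : X -> X -> nat) (dY : Y -> Y -> nat).

Definition controlled (phi : X -> Y) : Prop := forall n, exists m, forall a b,
  (dX a b <= n)%N -> (dY (phi a) (phi b) <= m)%N.

End CoarsePairs.

(** A form of coarse equivalence that is symmetric in the two spaces and has natural constants. *)
Definition coarse_inverses (X Y : Type) (dX : X -> X -> nat)
    (dY : Y -> Y -> nat) (phi : X -> Y) (psi : Y -> X) (C : nat) : Prop :=
  [/\ controlled dX dY phi, controlled dY dX psi,
      forall a, (dX a (psi (phi a)) <= C)%N &
      forall b, (dY b (phi (psi b)) <= C)%N].

Lemma coarse_inverses_sym (X Y : Type) (dX : X -> X -> nat)
    (dY : Y -> Y -> nat) (phi : X -> Y) (psi : Y -> X) (C : nat) :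
  coarse_inverses dX dY phi psi C -> coarse_inverses dY dX psi phi C.
Proof. by case. Qed.

Lemma nat_of_real_bound (R : realType) (x : R) : exists n : nat, x <= n%:R.
Proof.
exists (Num.bound `|x|); apply: le_trans (ler_norm x) _.
by apply/ltW/archi_boundP; exact: normr_ge0.
Qed.

(* A proper function need not be bounded on bounded sets, but the distances
   are natural numbers, so only finitely many values are involved. *)
Lemma coarsely_equivalent_inverses (R : realType) (X Y : Type)
    (dX : X -> X -> nat) (dY : Y -> Y -> nat) :
  (forall a b, dY a b = dY b a) ->
  (forall a b c, dY a c <= dY a b + dY b c)%N ->
  coarsely_equivalent (fun a b => (dX a b)%:R : R) (fun a b => (dY a b)%:R : R) ->
  exists phi psi C, coarse_inverses dX dY phi psi C.
Proof.
move=> symY triY [phi [[rm [rp [[rm0 rmP] _ rmp]]] [C0 [_ phiC]]]].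
have [C C0C] := nat_of_real_bound C0.
have /choice[psi psiC] : forall y, exists x, (dY y (phi x) <= C)%N.
  move=> y; have [x yx] := phiC y; exists x.
  by rewrite -(ler_nat R); exact: le_trans yx C0C.
have up : controlled dX dY phi.
  move=> n; have [|k _|m hm] := finite_set_bound (F := `I_n.+1)
      (P := fun k m => rp k%:R <= m%:R) (finite_II _).
  - by move=> k m m' mm' /le_trans; apply; rewrite ler_nat.
  - exact: nat_of_real_bound.
  - exists m => a b abn; rewrite -(ler_nat R).
    by have /andP[_ /le_trans] := rmp a b; apply; exact: hm.
(* Properness of [rm] is applied to the interval from 0 to [n]. *)
have low n : exists m, forall a b,
    (dY (phi a) (phi b) <= n)%N -> (dX a b <= m)%N.
  have : bounded_set [set t : R | 0 <= t <= n%:R].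
    exists n%:R; split; first exact: num_real.
    move=> x nx t /= /andP[t0 tn]; rewrite ger0_norm //.
    exact: le_trans tn (ltW nx).
  (* Every real strictly above [B] bounds the set, hence the choice of [B + 1]. *)
  move=> /rmP[B [_ hB]]; have [m Bm] := nat_of_real_bound (B + 1).
  exists m => a b abn; rewrite -(ler_nat R); apply: le_trans Bm.
  rewrite -[X in X <= _]ger0_norm //; apply: hB; first by rewrite ltrDl.
  split; first by rewrite /= ler0n.
  have /andP[h _] := rmp a b; rewrite /= rm0 ?ler0n //=.
  by apply: le_trans h _; rewrite ler_nat.
have phipsi b b' n : (dY b b' <= n)%N ->
    (dY (phi (psi b)) (phi (psi b')) <= C + (n + C))%N.
  move=> bb'; apply: leq_trans (triY _ b _) _; apply: leq_add.
    by rewrite symY.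
  by apply: leq_trans (triY _ b' _) _; apply: leq_add.
have [m lowC] := low C.
exists phi, psi, (C + m)%N; split=> //.
- move=> n; have [k lowk] := low (C + (n + C))%N.
  by exists k => b b' /phipsi/lowk.
- move=> a; apply: leq_trans (leq_addl _ _); apply: lowC; exact: psiC.
- move=> b; apply: leq_trans (leq_addr _ _); exact: psiC.
Qed.

(** * Matching the components of the two box spaces *)

Section ComponentMatching.
Local Open Scope group_scope.

(* Adjacent points have images at bounded distance, whereas distinct components
   of large diameter are far apart. *)
Lemma controlled_box_tag (G H : groupType) (S : set G) (T : set H)
    (N : nat -> normalSubgroup G) (M : nat -> normalSubgroup H)
    (phi : box_space N -> box_space M) :
  finite_generating_set S -> filtration N ->
  finite_generating_set T -> filtration M -> unbounded_group T ->
  controlled (@box_nat_dist G S N) (@box_nat_dist H T M) phi ->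
  exists J, forall i (x y : quotient (N i)),
    (J <= tag (phi (existT _ i x)))%N ->
    tag (phi (existT _ i y)) = tag (phi (existT _ i x)).
Proof.
move=> genS filN genT filM unbT /(_ 1%N)[m phim].
have [J hJ] := component_diam_unbounded genT filM m unbT.
exists J => i x y Jx.
have [g Sg ->] : exists2 g, exists n, ball S n g & y = x * quotient_map (N i) g.
  exists (repr (x^-1 * y)); last by rewrite quotient_map_repr mulVKg.
  by apply: generated_ball; case: genS => _ ->.
case: Sg => n; elim: n g x Jx {y} => [|n IH] g x Jx.
  by move=> ->; rewrite multiplicative1 mulg1.
move=> [s [h [Ss nh ->]]]; rewrite quotient_map_mul mulgA.
have xs : tag (phi (existT _ i (x * quotient_map (N i) s))) =
    tag (phi (existT _ i x)).
  apply: (box_nat_dist_tag (S := T)) (hJ _ Jx); apply: phim.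
  rewrite box_nat_dist_same; apply/(component_nat_dist_le genS).
  exists s => //; case: Ss => [->|]; [exact: ball_one|exact: ball_letter].
by rewrite IH // xs.
Qed.

Variables (G H : groupType) (S : set G) (T : set H).
Variables (N : nat -> normalSubgroup G) (M : nat -> normalSubgroup H).
Variables (phi : box_space N -> box_space M) (psi : box_space M -> box_space N).
Variable C : nat.
Hypotheses (genS : finite_generating_set S) (genT : finite_generating_set T).
Hypotheses (filN : filtration N) (filM : filtration M).
Hypothesis phipsi :
  coarse_inverses (@box_nat_dist G S N) (@box_nat_dist H T M) phi psi C.
Hypothesis unbS : unbounded_group S.

(** The lower control on [phi] comes from the upper control on [psi], since [psi (phi a)] is within
    [C] of [a]. *)
Lemma coarse_inverses_lower n : exists m, forall a b,
  (box_nat_dist T (phi a) (phi b) <= n)%N -> (box_nat_dist S a b <= m)%N.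
Proof.
have [_ psiK aC _] := phipsi; have [m hm] := psiK n.
exists (C + (m + C))%N => a b /hm ab.
apply: leq_trans (box_nat_dist_triangle genS filN _ (psi (phi a)) _) _.
apply: leq_add => //.
apply: leq_trans (box_nat_dist_triangle genS filN _ (psi (phi b)) _) _.
by apply: leq_add => //; rewrite (box_nat_dist_sym genS).
Qed.

(** Otherwise the box space of [H] would be bounded, and by the lower control so would the diameters
    of the components for [G]. *)
Lemma coarse_inverses_unbounded : unbounded_group T.
Proof.
move=> D; apply: contrapT => /forallNP hD.
have {}hD h : ball T D h by apply: contrapT; exact: hD.
have [m hm] := coarse_inverses_lower (D + D).
have [I /(_ I (leqnn I))] := component_diam_unbounded genS filN m unbS.
rewrite ltnNge => /negP; apply; apply/(component_diamP S filN) => x y.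
rewrite -box_nat_dist_same; apply: hm; exact: box_nat_dist_bounded.
Qed.

(** The components of small index have a bounded union, so a component of large diameter cannot be
    sent into it; one point of large image index then decides for the whole component. *)
Lemma component_image_large J : exists I, forall i, (I <= i)%N ->
  exists2 j, (J <= j)%N & forall x : quotient (N i), tag (phi (existT _ i x)) = j.
Proof.
have [phiK _ _ _] := phipsi.
have [J0 tagJ0] :=
  controlled_box_tag genS filN genT filM coarse_inverses_unbounded phiK.
have [D hD] := box_nat_dist_initial T filM (maxn J J0).
have [m hm] := coarse_inverses_lower D.
have [I hI] := component_diam_unbounded genS filN m unbS.
exists I => i /hI mi.
have [[x]|] := pselect (exists x, maxn J J0 <= tag (phi (existT _ i x)))%N.
  rewrite geq_max => /andP[Jx J0x]; exists (tag (phi (existT _ i x))) => // y.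
  exact: tagJ0.
move=> /forallNP small; exfalso; move: mi; rewrite ltnNge => /negP; apply.
apply/(component_diamP S filN) => x y; rewrite -box_nat_dist_same; apply: hm.
by apply: hD; rewrite ltnNge; apply/negP; exact: small.
Qed.

(** If the diameter of component [i] exceeds [C], then [psi (phi q)] is still in it, so [psi] sends
    the component [j] that receives [phi q] back to [i]. *)
Lemma matching_components I J : exists i j, [/\ (I <= i)%N, (J <= j)%N,
  forall x : quotient (N i), tag (phi (existT _ i x)) = j &
  forall y : quotient (M j), tag (psi (existT _ j y)) = i].
Proof.
have [_ psiK aC _] := phipsi.
have [I0 tagI0] := controlled_box_tag genT filM genS filN unbS psiK.
have [I1 hI1] := component_diam_unbounded genS filN C unbS.
have [I2 hI2] := component_image_large J.
pose i := maxn (maxn I I0) (maxn I1 I2).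
have [j Jj phij] := hI2 i ltac:(by rewrite /i; lia).
pose q : quotient (N i) := 1.
have psi1 : tag (psi (phi (existT _ i q))) = i.
  by apply: (box_nat_dist_tag (S := S) (aC _)); apply: hI1; rewrite /i /=; lia.
exists i, j; split=> //; first by rewrite /i; lia.
move: (phij q) psi1; case: (phi (existT _ i q)) => j' y0 /= j'j; subst j'.
move=> psi1 y; rewrite (tagI0 _ y0 y) // psi1 /i; lia.
Qed.

End ComponentMatching.

(** * Transfer of a positive rank gradient *)

Section Transfer.
Local Open Scope group_scope.

Lemma subgroup_rank_transfer (G H : groupType) (A : set G) (B : set H)
    (X : seq H) : generated [set` X] = B ->
  (forall Y, generated Y = B -> exists th : H -> G, generated (th @` Y) = A) ->
  (subgroup_rank A <= subgroup_rank B)%N.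
Proof.
move=> /subgroup_rankP[_ [Y <- genY]] /(_ _ genY)[f].
have -> : f @` [set` Y] = [set` map f Y].
  apply/seteqP; split=> x /=; first by move=> [y Yy <-]; exact: map_f.
  by move=> /mapP[y Yy ->]; exists y.
by move=> /subgroup_rankP[+ _]; rewrite size_map.
Qed.

Lemma box_space_tag (G : groupType) (N : nat -> normalSubgroup G) j
    (a : box_space N) : tag a = j -> exists y : quotient (N j), a = existT _ j y.
Proof. by case: a => i x /= <-; exists x. Qed.

Lemma rank_gradient_gt0_coarse (R : realType) (G H : groupType)
    (S : set G) (T : set H) (N : nat -> normalSubgroup G)
    (M : nat -> normalSubgroup H)
    (phi : box_space N -> box_space M) (psi : box_space M -> box_space N)
    (C : nat) :
  finitely_presented H ->
  finite_generating_set S -> finite_generating_set T ->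
  filtration N -> filtration M ->
  coarse_inverses (@box_nat_dist G S N) (@box_nat_dist H T M) phi psi C ->
  (0 < rank_gradient R N -> 0 < rank_gradient R M)%R.
Proof.
move=> [n [r [finr [f [fsurj kerf]]]]] genS genT filN filM phipsi RG.
have unbS : unbounded_group S.
  by move=> k; exact: (rank_gradient_gt0_unbounded genS filN k RG).
have [phiK psiK aC bC] := phipsi.
have [[finS SG] [finT TH]] := (genS, genT).
have [sC sCP] := finite_set_enum (finite_ball C finT).
apply: (rank_gradient_gt0_transfer (K := size sC) genS genT filN filM _ RG) => k.
(* The letters of the presentation need not map into [T]; [L] bounds the length of their images. *)
have [L hL] := finite_sub_ball TH
  (finite_image (fun l : bool * 'I_n => word_eval f [:: l]) (@finite_finset _ setT)).
(* [R0] bounds the displacement of [psi] along a letter of the presentation, and [m] that of [phi]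
   along a generator in [S]. *)
have [R0 hR0] := psiK L; have [m hm] := phiK 1%N.
have [| |R' hR'] := finite_set_bound
  (P := fun h k => exists2 w, (size w <= k)%N & word_eval f w = h)
  (finite_ball m finT).
- by move=> h k1 k2 k12 [w wk wh]; exists w => //; exact: leq_trans k12.
- move=> h _; have : range f h by rewrite fsurj.
  by move=> [z _ <-]; have [w <-] := of_word_surj z; exists (size w), w.
have [| |Q hQ] := finite_set_bound
  (P := fun z k => exists2 w, z = of_word w & (size w <= k)%N) finr.
- by move=> h k1 k2 k12 [w wk wh]; exists w => //; exact: leq_trans k12.
- by move=> z _; have [w <-] := of_word_surj z; exists (size w), w.
(* The summands serve the cancelling pairs, the comparison in [word_cocycle_conj], and the relators,
   whose words have length at most [Q]. *)
pose K := (R0 + R0 + (R0 * R' + (C + 1 + C)) + R0 * Q)%N.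
have [I hI] := ball_trivial_inter K finS filN.
have [i [j [Ii kj phij psij]]] :=
  matching_components genS genT filN filM phipsi unbS I k.
have /choice[phi' phiE] : forall x : quotient (N i), exists y,
    phi (existT _ i x) = existT _ j y.
  by move=> x; exact: box_space_tag.
have /choice[psi' psiE] : forall y : quotient (M j), exists x,
    psi (existT _ j y) = existT _ i x.
  by move=> y; exact: box_space_tag.
have phi_word x s : S s \/ S s^-1 -> exists2 w : word 'I_n, (size w <= R')%N &
    (phi' x)^-1 * phi' (x * quotient_map (N i) s) =
    quotient_map (M j) (word_eval f w).
  move=> Ss; have := hm (existT _ i x) (existT _ i (x * quotient_map (N i) s)).
  rewrite !phiE !box_nat_dist_same => /(_ _)/(component_nat_dist_le genT)[].
    by apply/(component_nat_dist_le genS); exists s => //; exact: ball_letter.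
  by move=> h /hR'[w wR' <-] ->; exists w => //; rewrite mulKg.
have /choice[a aP] : forall p : quotient (M j) * (bool * 'I_n), exists g,
    ball S R0 g /\ quotient_map (N i) g =
      (psi' p.1)^-1 * psi' (p.1 * quotient_map (M j) (word_eval f [:: p.2])).
  move=> [y l] /=; set h := word_eval f _.
  have := hR0 (existT _ j y) (existT _ j (y * quotient_map (M j) h)).
  rewrite !psiE !box_nat_dist_same => /(_ _)/(component_nat_dist_le genS)[].
    by apply/(component_nat_dist_le genT); exists h => //; apply: hL; exists l.
  by move=> g Sg ->; exists g; rewrite mulKg.
have /choice[u uP] : forall x : quotient (N i), exists g,
    ball S C g /\ quotient_map (N i) g = x^-1 * psi' (phi' x).
  move=> x; have := aC (existT _ i x); rewrite phiE psiE box_nat_dist_same.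
  by move=> /(component_nat_dist_le genS)[g Sg ->]; exists g; rewrite mulKg.
exists i, j; split=> //.
  have [X genX] := filtration_fg genT filM j.
  apply: (subgroup_rank_transfer genX) => Y genY.
  apply: (generated_transfer (S := S) (R := R0) (K := K)
    (a := fun y l => a (y, l)) kerf _ _ _ _ _ fsurj SG phi_word
    (fun x => (uP x).1) (fun x => (uP x).2) _ genY).
  - by move=> y l; case: (aP (y, l)).
  - by move=> y l; case: (aP (y, l)).
  - exact: hI.
  - by rewrite /K -addnA leq_addr.
  - move=> z /hQ[w zw wQ]; exists w => //.
    by rewrite (leq_trans (_ : _ <= R0 * Q)%N) ?leq_mul2l ?wQ ?orbT ?leq_addl.
  - by rewrite /K; lia.
have [s0 s0P] := filtration_enum filN i; have [s1 s1P] := filtration_enum filM j.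
rewrite (subgroup_index_enum s0P) (subgroup_index_enum s1P).
(* Each [y] is within [C] of [phi' (psi' y)], so it is determined by a point of the quotient by
   [N i] and an element of the ball of radius [C] in [H]. *)
rewrite -(size_allpairs (fun x h => phi' x / quotient_map (M j) h)).
have [us1 _] := s1P; apply: uniq_leq_size => // y _.
have := bC (existT _ j y); rewrite psiE phiE box_nat_dist_same.
move=> /(component_nat_dist_le genT)[h Th yh].
apply/allpairsP; exists (psi' y, h) => /=; split.
- exact/(proj2 s0P).
- exact/(proj2 sCP).
- by rewrite yh mulgK.
Qed.

End Transfer.

Theorem theorem1p8 (R : realType) (G H : groupType)
    (N : nat -> normalSubgroup G) (M : nat -> normalSubgroup H)
    (SG : set G) (SH : set H) :
  finitely_presented G -> residually_finite G ->
  finitely_presented H -> residually_finite H ->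
  filtration N -> filtration M ->
  finite_generating_set SG -> finite_generating_set SH ->
  coarsely_equivalent (@box_dist R G SG N) (@box_dist R H SH M) ->
  (0 < rank_gradient R N <-> 0 < rank_gradient R M).
Proof.
move=> fpG _ fpH _ filN filM genG genH.
rewrite !box_distE // => /coarsely_equivalent_inverses[].
- exact: box_nat_dist_sym.
- exact: box_nat_dist_triangle.
(* Positivity passes to [H] through the presentation of [H], and back to [G] through that of [G]
   with the two maps exchanged. *)
move=> phi [psi [C phipsi]]; split.
  exact: (rank_gradient_gt0_coarse fpH genG genH filN filM phipsi).
exact: (rank_gradient_gt0_coarse fpG genH genG filM filN
  (coarse_inverses_sym phipsi)).
Qed.
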